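(* Let $m$ be a positive integer with $2\,\|\, m$ (i.e. $2\mid m$ but $4\nmid m$). Let $A, B\subseteq \mathbb{Z}_{m}$ satisfy $A\cup B=\mathbb{Z}_{m}$ and $|A\cap B|=4$ or $|A\cap B|=m-4$. Then $R_{A}(\overline{n})=R_{B}(\overline{n})$ for all $\overline{n}\in \mathbb{Z}_{m}$ if and only if $B=A+\overline{\frac{m}{2}}$.
   Context: $\mathbb{Z}_m$ denotes the set (group) of residue classes modulo $m$. For $A\subseteq\mathbb{Z}_m$ and $\overline{n}\in\mathbb{Z}_m$, $R_A(\overline{n})$ is the number of ordered pairs $(\overline{a},\overline{a'})\in A\times A$ with $\overline{a}+\overline{a'}=\overline{n}$. For $\overline{c}\in\mathbb{Z}_m$, $A+\overline{c}=\{\overline{a}+\overline{c}:\overline{a}\in A\}$. *)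

(* Defs.v *)
From mathcomp Require Import all_boot all_order all_algebra.

Set Implicit Arguments.
Unset Strict Implicit.
Unset Printing Implicit Defensive.

Import GRing.Theory.
Local Open Scope ring_scope.

(* 'Z_m is the ring of residues modulo m only when m > 1; the definitions below
   are used for even positive m. *)

(* Ordered pairs, so (a, a') and (a', a) are both counted. *)
Definition repr_count (m : nat) (A : {set 'Z_m}) (n : 'Z_m) : nat :=
  #|[set p : 'Z_m * 'Z_m | [&& p.1 \in A, p.2 \in A & p.1 + p.2 == n]]|.

Definition translate (m : nat) (A : {set 'Z_m}) (c : 'Z_m) : {set 'Z_m} :=
  [set a + c | a in A].

(* Main.v *)
(** Let [f] be the difference of the indicators of [A] and [B], let
    [C = A :&: B] and [h = m / 2].  Since [A :|: B] is everything, the sum of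
    the two indicators is [1 + 1_C], so [R_A = R_B] says that the convolution
    of [f] with [1 + 1_C] vanishes; then [f] has sum [0] and its convolutions
    with [1_C] and with the indicator of [~: C] both vanish.  Let [T] be the
    one of [C], [~: C] that has four elements.  Since [f] is odd exactly off
    [C], reduction modulo 2 shows that [R_T] takes even values.  Modulo 2,
    [R_T n] counts the [x] in [T] with [x + x = n], and the fibres of doubling
    are the cosets of [{0, h}]; so [T + h = T] and [T = {a, a+h, b, b+h}].
    Then [g x = f x + f (x + h)] satisfies [g (x + (a - b)) = - g x]; iterating
    this [m / 2] times, an odd number, gives [g = - g], i.e.
    [f (x + h) = - f x], which amounts to [B = A + h]. *)
Require Import Defs.
From mathcomp Require Import all_boot all_order all_algebra.
From mathcomp Require Import zify ring.

Set Implicit Arguments.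
Unset Strict Implicit.
Unset Printing Implicit Defensive.

Import Order.TTheory GRing.Theory Num.Theory.
Local Open Scope ring_scope.

(** The points moved by [s] pair off as [x], [s x]. The rank in the enumeration of [T] picks one
    point of each pair, so they split into two halves exchanged by [s]. *)
Lemma odd_card_involution (T : finType) (s : T -> T) (S : {set T}) :
  involutive s -> (forall x, x \in S -> s x \in S) ->
  odd #|S| = odd #|[set x in S | s x == x]|.
Proof.
move=> sK sS; pose lt (x y : T) := (enum_rank x < enum_rank y)%N.
have SsE x : (s x \in S) = (x \in S).
  by apply/idP/idP => [/sS|/sS //]; rewrite sK.
have eq_swap : #|[set x in S | lt x (s x)]| = #|[set x in S | lt (s x) x]|.
  rewrite -(card_imset _ (inv_inj sK)); apply: eq_card => x.
  apply/imsetP/idP => [[y] | xS].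
    by rewrite !inE => /andP[yS ylt] ->; rewrite SsE yS sK.
  by exists (s x); rewrite ?sK // !inE SsE sK; move: xS; rewrite inE.
have {1}-> : S = [set x in S | lt x (s x)] :|: [set x in S | lt (s x) x]
              :|: [set x in S | s x == x].
  apply/setP=> x; rewrite !inE -!andb_orr; case: (x \in S) => //=.
  rewrite -(inj_eq enum_rank_inj) -(inj_eq val_inj) /lt /=.
  by case: ltngtP.
rewrite cardsU cardsU.
set I := _ :&: _; have -> : I = set0.
  by apply/setP=> x; rewrite !inE /lt; case: (x \in S) => //=; case: ltngtP.
set J := _ :&: _; have -> : J = set0.
  apply/setP=> x; rewrite !inE /lt; case: (x \in S) => //=.
  by case: (eqVneq (s x) x) => [->|_]; rewrite ?ltnn ?andbF.
by rewrite !cards0 !subn0 eq_swap addnn oddD odd_double /=.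
Qed.

(** If [a] is in [T] but [a + h] is not, then [a] is the only fixed point in [T] of the involution
    [x -> a + a - x], so the count at [n = a + a] is odd. *)
Lemma even_sums_shift_closed (V : finZmodType) (h : V) (T : {set V}) :
    h + h = 0 -> (forall x : V, x + x = 0 -> x = 0 \/ x = h) ->
    (forall n, ~~ odd #|[set x in T | n - x \in T]|) ->
  forall a, a \in T -> a + h \in T.
Proof.
move=> hh hker evT a aT; apply/idPn => ahT.
have := evT (a + a); rewrite (@odd_card_involution _ (fun x => a + a - x)).
- suff -> : [set x in [set x in T | a + a - x \in T] | a + a - x == x] = [set a].
    by rewrite cards1.
  apply/setP=> x; rewrite !inE; apply/idP/eqP => [|->]; last first.
    by rewrite addrK aT eqxx.
  case/andP=> /andP[xT _] /eqP eq_x.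
  have [|/eqP|xa] := hker (x - a).
  + by rewrite addrACA -opprD -[X in _ - X](subrK x) eq_x subrr.
  + by rewrite subr_eq0 => /eqP.
  + by case/negP: ahT; rewrite -xa addrC subrK.
- by move=> x; rewrite subKr.
- by move=> x; rewrite !inE subKr andbC.
Qed.

Lemma shift_antiperiodic (V : finZmodType) (h : V) (k : nat) (T : {set V})
    (f : V -> int) :
    h != 0 -> h + h = 0 -> odd k -> (forall x : V, x *+ k = 0 \/ x *+ k = h) ->
    #|T| = 4%N -> (forall a, a \in T -> a + h \in T) ->
    (forall n, \sum_(t in T) f (n - t) = 0) ->
  forall x, f (x + h) = - f x.
Proof.
move=> h0 hh k_odd kV cT Th fT x.
have opph : - h = h by apply/esym/eqP; rewrite -addr_eq0 hh.
have ne_h (y : V) : (y + h == y) = false.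
  by rewrite -subr_eq0 addrC addKr (negbTE h0).
have [a aT] : exists a, a \in T by apply/card_gt0P; rewrite cT.
have [b] : exists b, b \in T :\ a :\ (a + h).
  apply/card_gt0P; have := cardsD1 a T; have := cardsD1 (a + h) (T :\ a).
  by rewrite !inE ne_h aT Th // cT => ->; case: #|_|.
rewrite !inE => /and3P[b_ah b_a bT].
have Tsum (F : V -> int) :
    \sum_(t in T) F t = F a + F (a + h) + (F b + F (b + h)).
  pose r := [:: a; a + h; b; b + h].
  have r_uniq : uniq r.
    have bh_a : b + h != a.
      by apply: contraNneq b_ah => <-; rewrite -addrA hh addr0.
    rewrite /= !inE !negb_or (inj_eq (addIr h)) (eq_sym a b) (eq_sym (a + h)).
    rewrite (eq_sym a (a + h)) (eq_sym a (b + h)) (eq_sym b (b + h)) !ne_h.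
    by rewrite b_a b_ah bh_a.
  have rT : {subset r <= enum T}.
    by apply/allP; rewrite /= !mem_enum !Th ?aT ?bT.
  have [|_ r_eq] := uniq_min_size r_uniq rT; first by rewrite -cardE cT.
  rewrite -big_enum (perm_big r) ?uniq_perm ?enum_uniq //.
  by rewrite !big_cons big_nil /= addr0 !addrA.
pose g y := f y + f (y + h).
have g_per y : g (y + h) = g y by rewrite /g -addrA hh addr0 addrC.
have g_opp y : g (y + (a - b)) = - g y.
  (* At [n = y + a], the terms for [a], [a + h] make up [g y] and those for [b], [b + h] make up
     [g (y + (a - b))], because [- h = h]. *)
  apply/eqP; rewrite -addr_eq0 addrC; apply/eqP.
  rewrite -[RHS](fT (y + a)) Tsum /g !opprD opph !addrA addrK.
  by rewrite -!addrA.
have g_iter j y : g (y + (a - b) *+ j) = (-1) ^+ j * g y.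
  elim: j => [|j IH]; first by rewrite mulr0n addr0 mul1r.
  by rewrite mulrSr addrA g_opp IH exprS mulN1r mulNr.
have : g x = - g x.
  have := g_iter k x; rewrite -signr_odd k_odd expr1 mulN1r.
  (* The total shift is [0] or [h], and [g] is invariant under both. *)
  by case: (kV (a - b)) => ->; rewrite ?addr0 ?g_per.
by rewrite /g; lia.
Qed.

Lemma repr_count_sum m (A : {set 'Z_m}) n :
  (repr_count A n)%:R = \sum_x (x \in A)%:R * (n - x \in A)%:R :> int.
Proof.
have -> : repr_count A n = #|[set x in A | n - x \in A]|.
  have inj : injective (fun x => (x, n - x)) by move=> x y [].
  rewrite /repr_count -(card_imset _ inj); apply: eq_card => -[x y].
  rewrite !inE /=; apply/and3P/imsetP => [[xA yA /eqP<-]|[z]].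
    by exists x; rewrite ?inE addrC addKr ?xA.
  by rewrite !inE => /andP[zA nzA] [-> ->]; rewrite subrKC.
rewrite -sum1_card natr_sum big_mkcond /=; apply: eq_bigr => x _.
by rewrite inE; do 2!case: (_ \in A).
Qed.

Lemma sum_mem_shift (V : finZmodType) (T : {set V}) (y : V) :
  \sum_x (y - x \in T)%:R = #|T|%:R :> int.
Proof.
rewrite (reindex_inj (inv_inj (fun x => subKr y x))) /=.
rewrite -sum1_card natr_sum [RHS]big_mkcond /=; apply: eq_bigr => x _.
by rewrite subKr; case: (x \in T).
Qed.

Section EqualRepresentationCounts.

Variables (m : nat) (A B : {set 'Z_m}).
Hypothesis AUB : A :|: B = [set: 'Z_m].
Hypothesis RAB : forall n : 'Z_m, repr_count A n = repr_count B n.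

Let f (x : 'Z_m) : int := (x \in A)%:R - (x \in B)%:R.

(** With [*] for convolution, (1_A - 1_B) * (1_A + 1_B) = 1_A * 1_A - 1_B * 1_B: the cross terms
    cancel by commutativity, which is [swap]. *)
Lemma conv_diff_cover n : \sum_x f x * (1 + (n - x \in A :&: B)%:R) = 0.
Proof.
have cover y : 1 + (y \in A :&: B)%:R = (y \in A)%:R + (y \in B)%:R :> int.
  by have := in_setT y; rewrite -AUB !inE; do 2!case: (y \in _).
have swap : \sum_x ((x \in A)%:R * (n - x \in B)%:R : int) =
            \sum_x (x \in B)%:R * (n - x \in A)%:R.
  rewrite (reindex_inj (inv_inj (fun x => subKr n x))) /=.
  by apply: eq_bigr => x _; rewrite subKr mulrC.
transitivity ((repr_count A n)%:R - (repr_count B n)%:R : int); last first.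
  by rewrite RAB subrr.
rewrite !repr_count_sum; apply/eqP; rewrite -subr_eq0.
move/eqP: swap; rewrite -subr_eq0 => /eqP swap.
rewrite -[X in _ == X]swap; apply/eqP; rewrite -!sumrB; apply: eq_bigr => x _.
by rewrite cover /f; ring.
Qed.

(** Summing the previous identity over [n] gives the sum of [f] times [#|'Z_m| + #|A :&: B|], a
    positive factor. *)
Lemma sum_diff0 : \sum_x f x = 0.
Proof.
have : \sum_n \sum_x f x * (1 + (n - x \in A :&: B)%:R) = 0.
  by apply: big1 => n _; apply: conv_diff_cover.
rewrite exchange_big /=.
under eq_bigr => x _.
  rewrite -mulr_sumr big_split /= sumr_const.
  rewrite (reindex_inj (addIr x)) /=.
  under [X in _ + X]eq_bigr => n _ do rewrite addrK.
  over.
rewrite -mulr_suml => /eqP; rewrite mulf_eq0 => /orP[/eqP //|].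
rewrite gt_eqF // ltr_wpDr ?sumr_ge0 ?ltr0n //.
by apply/card_gt0P; exists 0.
Qed.

Lemma conv_diff_capI n : \sum_x f x * (n - x \in A :&: B)%:R = 0.
Proof.
have : \sum_x f x + \sum_x f x * (n - x \in A :&: B)%:R = 0.
  rewrite -[RHS](conv_diff_cover n) -big_split /=.
  by apply: eq_bigr => x _; rewrite mulrDr mulr1.
by rewrite sum_diff0 add0r.
Qed.

Lemma conv_diff_capC n : \sum_x f x * (n - x \in ~: (A :&: B))%:R = 0.
Proof.
have e0 : \sum_x f x - \sum_x f x * (n - x \in A :&: B)%:R = 0.
  by rewrite conv_diff_capI sum_diff0 subr0.
rewrite -[RHS]e0 -sumrB; apply: eq_bigr => x _; rewrite in_setC.
by case: (_ \in _); rewrite /= ?mulr0 ?mulr1 ?subrr ?subr0.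
Qed.

(** Convolve the expression for 1_T with 1_T itself: the [f] term vanishes, the constant contributes
    [c * 4], and the rest is even. The parameters [c], [s], [e] let one argument serve both for
    [A :&: B] and for its complement. *)
Lemma even_repr_conv0 (T : {set 'Z_m}) (c s : int)
    (e : 'Z_m -> int) :
    #|T| = 4%N -> (forall n, \sum_x f x * (n - x \in T)%:R = 0) ->
    (forall x, (x \in T)%:R = c + s * f x + 2 * e x) ->
  forall n, ~~ odd #|[set x in T | n - x \in T]|.
Proof.
move=> cT fT TE n.
have : #|[set x in T | n - x \in T]|%:R =
       c * #|T|%:R + 2 * \sum_x e x * (n - x \in T)%:R :> int.
  rewrite -sum1_card natr_sum big_mkcond /= -(sum_mem_shift T n).
  have sfT : s * \sum_x f x * (n - x \in T)%:R = 0 by rewrite fT mulr0.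
  rewrite -[RHS]addr0 -[X in _ = _ + X]sfT !mulr_sumr -!big_split /=.
  apply: eq_bigr => x _; rewrite inE.
  transitivity ((x \in T)%:R * (n - x \in T)%:R : int).
    by do 2!case: (_ \in T).
  by rewrite TE; ring.
by rewrite cT; move: (\sum_x _) => z; lia.
Qed.

End EqualRepresentationCounts.

(** Adding [c] to both entries of a pair changes its sum by [c + c = 0]. *)
Lemma eq_repr_count_translate (m : nat) (A : {set 'Z_m}) (c : 'Z_m) :
  c + c = 0 -> forall n, repr_count A n = repr_count (translate A c) n.
Proof.
move=> cc n; have inj : injective (fun p : 'Z_m * 'Z_m => (p.1 + c, p.2 + c)).
  move=> [x y] [x' y'] e; have /= /addIr -> := congr1 fst e.
  by have /= /addIr -> := congr1 snd e.
have tA x : x \in A -> x + c \in translate A c.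
  by move=> xA; apply/imsetP; exists x.
rewrite /repr_count -(card_imset _ inj).
apply: eq_card => -[x y]; rewrite !inE /=; apply/imsetP/and3P => [[[x' y']]|].
  rewrite inE /= => /and3P[x'A y'A /eqP<-] [-> ->].
  by rewrite !tA // addrACA cc addr0.
case=> /imsetP[x' x'A ->] /imsetP[y' y'A ->] /eqP<-.
by exists (x', y'); rewrite // inE /= x'A y'A addrACA cc addr0 eqxx.
Qed.

Theorem theorem1p3 (m : nat) (m_gt0 : (0 < m)%N)
    (m_even : (2 %| m)%N) (m_not4 : ~~ (4 %| m)%N)
    (A B : {set 'Z_m}) (AUB : A :|: B = [set: 'Z_m])
    (AIB : #|A :&: B| = 4%N \/ (#|A :&: B| + 4)%N = m) :
  (forall n : 'Z_m, repr_count A n = repr_count B n) <->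
  B = translate A ((m %/ 2)%:R).
Proof.
have m_gt1 : (1 < m)%N by lia.
have card_Zm : #|'Z_m| = m by rewrite card_ord Zp_cast.
(* This is where [4] not dividing [m] enters. *)
have k_odd : odd (m %/ 2) by lia.
set h : 'Z_m := (m %/ 2)%:R.
have h_val : h = (m %/ 2)%N :> nat by rewrite val_Zp_nat // modn_small //; lia.
have h0 : h != 0 by rewrite -(inj_eq val_inj) /= h_val; lia.
have Zm0 : m%:R = 0 :> 'Z_m by apply: pchar_Zp.
have hh : h + h = 0.
  by rewrite -natrD -[RHS]Zm0; congr _%:R; lia.
have hker (x : 'Z_m) : x + x = 0 -> x = 0 \/ x = h.
  have x_lt : (x < m)%N by rewrite -{2}(Zp_cast m_gt1) ltn_ord.
  rewrite -[x in x + x]natr_Zp -natrD => /(congr1 val) /=.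
  rewrite val_Zp_nat // => /eqP m_x.
  have [x0|xk] : (x = 0 :> nat \/ x = m %/ 2 :> nat)%N.
    move: (nat_of_ord x) x_lt m_x => n n_lt /dvdnP[q nq].
    have : (q < 2)%N by nia.
    by case: q nq => [|[|//]] nq _; lia.
    by left; apply: val_inj.
  by right; apply: val_inj; rewrite /= h_val.
have kV (x : 'Z_m) : x *+ (m %/ 2) = 0 \/ x *+ (m %/ 2) = h.
  apply: hker; rewrite -mulrnDr -mulr_natr.
  by rewrite (_ : _ + _ = m)%N ?Zm0 ?mulr0 //; lia.
split=> [RAB | ->]; last exact: eq_repr_count_translate.
pose f (x : 'Z_m) : int := (x \in A)%:R - (x \in B)%:R.
have cover x : (x \in A) || (x \in B) by rewrite -in_setU AUB inE.
have [T [c [s [e [cT fT TE]]]]] : exists (T : {set 'Z_m}) (c s : int)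
      (e : 'Z_m -> int),
    [/\ #|T| = 4%N, forall n, \sum_x f x * (n - x \in T)%:R = 0
      & forall x, (x \in T)%:R = c + s * f x + 2 * e x].
  case: AIB => cAB.
    (* Off [A] the cover puts [x] in [B] only, so [f x = -1]; the term [2 * e x] corrects the sign
       there, since 1_C is [1 - |f|]. *)
    exists (A :&: B), 1, (-1), (fun x => - (x \notin A)%:R); split=> //.
      exact: conv_diff_capI.
    by move=> x; have := cover x; rewrite /f inE; do 2!case: (x \in _).
  exists (~: (A :&: B)), 0, 1, (fun x => (x \notin A)%:R); split; last 2 first.
  - exact: conv_diff_capC.
  - by move=> x; have := cover x; rewrite /f !inE; do 2!case: (x \in _).
  by have := cardsC (A :&: B); rewrite card_Zm; lia.
have evT := even_repr_conv0 cT fT TE.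
have fh : forall x, f (x + h) = - f x.
  apply: (shift_antiperiodic h0 hh k_odd kV cT).
    exact: even_sums_shift_closed hh hker evT.
  (* The substitution [x -> n - x] turns the convolution into a sum over [T]. *)
  move=> n; rewrite -[RHS](fT n) big_mkcond /=.
  rewrite [RHS](reindex_inj (inv_inj (fun x => subKr n x))) /=.
  apply: eq_bigr => x _; rewrite subKr.
  by case: (x \in T); rewrite ?mulr1 ?mulr0.
apply/setP=> x.
(* The shift by [h] swaps the values [1] and [-1] of [f], that is, [A] only and [B] only; where [f]
   is [0], the cover forces membership in both sets. *)
have -> : (x \in B) = (x + h \in A).
  have := fh x; have := cover x; have := cover (x + h); rewrite /f.
  by do 4!case: (_ \in _).
apply/idP/imsetP => [xhA | [y yA ->]]; last by rewrite -addrA hh addr0.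
by exists (x + h); rewrite // -addrA hh addr0.
Qed.
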